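(* Let $t\geq 1$. For simple graphs $G$ and $H$, the following are equivalent: 1. $G$ and $H$ are not distinguished by the $t$-dimensional $\mathsf{mwl}$ algorithm; 2. $G$ and $H$ are homomorphism indistinguishable over $\mathcal{L}_t^+$; 3. $G$ and $H$ satisfy the same $\mathsf{M}^t$-sentences.
   Context: Graphs are finite, undirected, without multiple edges, and may have loops; simple means loopless. $\hom(F,G)$ is the number of homomorphisms from $F$ to $G$. $\mathfrak{S}_{2t}$ is the symmetric group; for a $2t$-tuple $\boldsymbol{x}$, $\sigma(\boldsymbol{x})$ is the tuple with entries permuted according to $\sigma$. Concatenation of tuples $\boldsymbol{r},\boldsymbol{s}$ is written $\boldsymbol{r}\boldsymbol{s}$. The mwl algorithm. The atomic type $\mathrm{atp}_G(x_1,\dots,x_{2t})$ of a tuple of vertices records which $x_i,x_j$ are equal and which are adjacent: $\mathrm{atp}_G(x_1,\dots,x_{2t})=\mathrm{atp}_H(y_1,\dots,y_{2t})$ iff for all $i,j$, $x_i=x_j\Leftrightarrow y_i=y_j$ and $x_ix_j\in E(G)\Leftrightarrow y_iy_j\in E(H)$. For $\boldsymbol{r},\boldsymbol{s}\in V(G)^t$ and $i\geq 1$ define $\mathsf{mwl}^0_G(\boldsymbol{r}\boldsymbol{s}) := \mathrm{atp}_G(\boldsymbol{r}\boldsymbol{s})$, $\mathsf{mwl}^{i-1/2}_G(\boldsymbol{r}\boldsymbol{s}) := (\mathsf{mwl}^{i-1}_G(\sigma(\boldsymbol{r}\boldsymbol{s})) \mid \sigma\in\mathfrak{S}_{2t})$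 (a family indexed by $\sigma$), and $\mathsf{mwl}^i_G(\boldsymbol{r}\boldsymbol{s})$ as the pair consisting of $\mathsf{mwl}^{i-1/2}_G(\boldsymbol{r}\boldsymbol{s})$ and the multiset of all pairs $(\mathsf{mwl}^{i-1/2}_G(\boldsymbol{r}\boldsymbol{t}),\mathsf{mwl}^{i-1/2}_G(\boldsymbol{t}\boldsymbol{s}))$ for $\boldsymbol{t}\in V(G)^t$. These are increasingly fine colourings of $V(G)^{2t}$; $\mathsf{mwl}^\infty_G$ denotes the finest (stable) colouring, where $\mathsf{mwl}^\infty_G(\boldsymbol{r}\boldsymbol{s})=\mathsf{mwl}^\infty_H(\boldsymbol{u}\boldsymbol{v})$ means $\mathsf{mwl}^i_G(\boldsymbol{r}\boldsymbol{s})=\mathsf{mwl}^i_H(\boldsymbol{u}\boldsymbol{v})$ for all $i\in\mathbb{N}$. $G$ and $H$ are not distinguished by the $t$-dimensional $\mathsf{mwl}$ algorithm if the multisets of colours $\mathsf{mwl}^\infty_G(\boldsymbol{r}\boldsymbol{s})$, $\boldsymbol{r},\boldsymbol{s}\in V(G)^t$, and $\mathsf{mwl}^\infty_H(\boldsymbol{u}\boldsymbol{v})$, $\boldsymbol{u},\boldsymbol{v}\in V(H)^t$, are the same. The class $\mathcal{L}_t^+$. A $(t,t)$-bilabelled graph is a tuple $\boldsymbol{F}=(F,\boldsymbol{u},\boldsymbol{v})$ with $F$ a graph and $\boldsymbol{u},\boldsymbol{v}\in V(F)^t$ (in-labels, out-labels). The series composition of $(F,\boldsymbol{u},\boldsymbol{v})$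 and $(F',\boldsymbol{u}',\boldsymbol{v}')$ is obtained from the disjoint union of $F$ and $F'$ by identifying $\boldsymbol{v}_i$ with $\boldsymbol{u}'_i$ for all $i$, with in-labels $\boldsymbol{u}$ and out-labels $\boldsymbol{v}'$. The parallel composition is obtained by identifying $\boldsymbol{u}_i$ with $\boldsymbol{u}'_i$ and $\boldsymbol{v}_i$ with $\boldsymbol{v}'_i$ for all $i$, with in-labels $\boldsymbol{u}$ and out-labels $\boldsymbol{v}$. Multiple edges are removed, loops kept. $\mathfrak{S}_{2t}$ acts by permuting the $2t$ labels. A $(t,t)$-bilabelled graph is atomic if all its vertices are labelled; $\mathcal{A}_t$ is the set of these. $\mathcal{L}_t^+$ is the class of $(t,t)$-bilabelled graphs generated by $\mathcal{A}_t$ under parallel composition, series composition, and the action of $\mathfrak{S}_{2t}$ on the labels. $G$ and $H$ are homomorphism indistinguishable over $\mathcal{L}_t^+$ if $\hom(F,G)=\hom(F,H)$ for all $\boldsymbol{F} = (F,\boldsymbol{u},\boldsymbol{v})\in\mathcal{L}_t^+$. The logic $\mathsf{M}^t$. An $\mathsf{M}^t$-formula has $2t$ free variables and is of one of the following forms: every quantifier-free first-order formula with equality over the signature $\{E\}$ (edge relation) with $2t$ variables is an $\mathsf{M}^t$-formula; if $\phi,\psi$ are $\mathsf{M}^t$-formulae with the same free variables, then $\neg\phi$, $\phi\land\psi$, $\phi\lor\psi$ are $\mathsf{M}^t$-formulae; if $\phi,\psi$ are $\mathsf{M}^t$-formulae and $n\in\mathbb{N}$, then $\exists^{\geq n}\boldsymbol{y}.(\phi(\boldsymbol{x},\boldsymbol{y})\land\psi(\boldsymbol{y},\boldsymbol{z}))$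 is an $\mathsf{M}^t$-formula, where $\boldsymbol{x},\boldsymbol{y},\boldsymbol{z}$ are pairwise disjoint $t$-tuples of distinct variables. An $\mathsf{M}^t$-sentence is an expression $\exists^{\geq n}\boldsymbol{x}.\ \phi(\boldsymbol{x})$ with $\phi$ an $\mathsf{M}^t$-formula, $\boldsymbol{x}$ a tuple of $2t$ distinct variables, and $n\in\mathbb{N}$. The quantifier $\exists^{\geq n}\boldsymbol{y}.\ \phi(\boldsymbol{y})$ means that at least $n$ many $|\boldsymbol{y}|$-tuples of vertices satisfy $\phi$. *)

(* Defs.v *)
From HB Require Import structures.
From mathcomp Require Import all_boot perm.
From mathcomp Require Import finmap multiset.

Set Implicit Arguments.
Unset Strict Implicit.
Unset Printing Implicit Defensive.

Local Open Scope mset_scope.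
Local Open Scope nat_scope.

Record graph := Graph {
  vertex :> finType;
  edge : rel vertex;
  edge_sym : symmetric edge
}.
Arguments edge {g}.

Definition simple_graph (G : graph) : Prop := irreflexive (@edge G).

Definition hom (F G : graph) : nat :=
  #|[set h : {ffun F -> G} |
      [forall x, forall y, edge x y ==> edge (h x) (h y)]]|.

(** ** Tuples of length [t + t] *)

(* [permt s (x_0, x_1, ...) = (x_(s 0), x_(s 1), ...)] *)
Definition permt (T : Type) (n : nat) (s : 'S_n) (x : n.-tuple T) :
  n.-tuple T := [tuple tnth x (s i) | i < n].

Definition ltup (T : Type) (t : nat) (x : (t + t).-tuple T) : t.-tuple T :=
  [tuple tnth x (lshift t i) | i < t].

Definition rtup (T : Type) (t : nat) (x : (t + t).-tuple T) : t.-tuple T :=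
  [tuple tnth x (rshift t i) | i < t].

(** ** The mwl algorithm *)

(* The colours of each round live in a type that depends only on [t] and on the
   round, so that colours in different graphs are compared by equality. *)

Definition atp_type (t : nat) : choiceType :=
  {ffun 'I_(t + t) * 'I_(t + t) -> bool * bool}.

Definition atp (t : nat) (G : graph) (x : (t + t).-tuple G) : atp_type t :=
  [ffun p => (tnth x p.1 == tnth x p.2, edge (tnth x p.1) (tnth x p.2))].

Definition half_colour (t : nat) (C : choiceType) : choiceType :=
  {ffun 'S_(t + t) -> C}.

Definition next_colour (C : choiceType) : choiceType :=
  (C * {mset C * C})%type.

Definition half_step (t : nat) (G : graph) (C : choiceType)
    (c : (t + t).-tuple G -> C) (x : (t + t).-tuple G) : half_colour t C :=
  [ffun s => c (permt s x)].

Definition full_step (t : nat) (G : graph) (C : choiceType)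
    (c : (t + t).-tuple G -> C) (x : (t + t).-tuple G) : next_colour C :=
  (c x,
   seq_mset [seq (c (cat_tuple (ltup x) w), c (cat_tuple w (rtup x)))
            | w : t.-tuple G]).

Fixpoint mwl_colour (t i : nat) : choiceType :=
  match i with
  | 0 => atp_type t
  | j.+1 => next_colour (half_colour t (mwl_colour t j))
  end.

Fixpoint mwl (t : nat) (G : graph) (i : nat) :
    (t + t).-tuple G -> mwl_colour t i :=
  match i with
  | 0 => @atp t G
  | j.+1 => full_step (half_step (@mwl t G j))
  end.

Definition mwl_infty_eq (t : nat) (G H : graph)
    (x : (t + t).-tuple G) (y : (t + t).-tuple H) : Prop :=
  forall i : nat, mwl i x = mwl i y.

(* Two multisets of colours are equal iff their index sets are related by a
   colour-preserving bijection. *)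
Definition mwl_not_distinguished (t : nat) (G H : graph) : Prop :=
  exists2 f : (t + t).-tuple G -> (t + t).-tuple H,
    bijective f & forall x, mwl_infty_eq x (f x).

(** ** Identification of vertices *)

Section Identify.

Variables (G : graph) (ps : seq (G * G)).

Definition glue : rel G := fun x y => ((x, y) \in ps) || ((y, x) \in ps).

Lemma glue_connect_sym : connect_sym glue.
Proof. by apply: sym_connect_sym => x y; rewrite /glue orbC. Qed.

(* The classes of the equivalence relation generated by [ps], each represented
   by its canonical element. *)
Definition class_of : finType := {x : G | x \in roots glue}.

Definition cls (x : G) : class_of :=
  exist _ (root glue x) (roots_root glue_connect_sym x).

Definition class_edge : rel class_of := fun a b =>
  [exists x, exists y, [&& cls x == a, cls y == b & edge x y]].

Lemma class_edge_sym : symmetric class_edge.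
Proof.
by move=> a b; apply/existsP/existsP => -[x /existsP[y /and3P[xa yb xy]]];
  exists y; apply/existsP; exists x; rewrite xa yb edge_sym xy.
Qed.

Definition identify : graph := Graph class_edge_sym.

End Identify.

Definition sum_edge (F F' : graph) : rel (F + F') := fun a b =>
  match a, b with
  | inl x, inl y => edge x y
  | inr x, inr y => edge x y
  | _, _ => false
  end.

Lemma sum_edge_sym (F F' : graph) : symmetric (@sum_edge F F').
Proof. by move=> [x|x] [y|y] //=; apply: edge_sym. Qed.

Definition disjoint_union (F F' : graph) : graph := Graph (@sum_edge_sym F F').

(** ** Bilabelled graphs *)

Record bilabelled (t : nat) := Bilabelled {
  under :> graph;
  in_lab : t.-tuple under;
  out_lab : t.-tuple under
}.

Definition labels (t : nat) (F : bilabelled t) : (t + t).-tuple F :=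
  cat_tuple (in_lab F) (out_lab F).

Definition glued (t : nat) (F F' : bilabelled t) (n : nat)
    (x : n.-tuple F) (y : n.-tuple F') : graph :=
  @identify (disjoint_union F F') (zip (map inl x) (map inr y)).

Definition glued_inl (t : nat) (F F' : bilabelled t) (n : nat)
    (x : n.-tuple F) (y : n.-tuple F') (v : F) : glued x y :=
  @cls (disjoint_union F F') (zip (map inl x) (map inr y)) (inl v).

Definition glued_inr (t : nat) (F F' : bilabelled t) (n : nat)
    (x : n.-tuple F) (y : n.-tuple F') (v : F') : glued x y :=
  @cls (disjoint_union F F') (zip (map inl x) (map inr y)) (inr v).

Definition series (t : nat) (F F' : bilabelled t) : bilabelled t :=
  @Bilabelled t (glued (out_lab F) (in_lab F'))
    (map_tuple (glued_inl (out_lab F) (in_lab F')) (in_lab F))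
    (map_tuple (glued_inr (out_lab F) (in_lab F')) (out_lab F')).

Definition parallel (t : nat) (F F' : bilabelled t) : bilabelled t :=
  @Bilabelled t (glued (labels F) (labels F'))
    (map_tuple (glued_inl (labels F) (labels F')) (in_lab F))
    (map_tuple (glued_inl (labels F) (labels F')) (out_lab F)).

Definition perm_labels (t : nat) (s : 'S_(t + t)) (F : bilabelled t) :
    bilabelled t :=
  @Bilabelled t F (ltup (permt s (labels F))) (rtup (permt s (labels F))).

Definition atomic (t : nat) (F : bilabelled t) : Prop :=
  forall v : F, v \in labels F.

(* Membership is not closed under isomorphism: compositions are represented by
   one concrete quotient. This is immaterial for homomorphism counts. *)
Inductive Lplus (t : nat) : bilabelled t -> Prop :=
| Lplus_atomic F : atomic F -> Lplus F
| Lplus_parallel F F' : Lplus F -> Lplus F' -> Lplus (parallel F F')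
| Lplus_series F F' : Lplus F -> Lplus F' -> Lplus (series F F')
| Lplus_perm s F : Lplus F -> Lplus (perm_labels s F).

Definition hom_indistinguishable_Lplus (t : nat) (G H : graph) : Prop :=
  forall F : bilabelled t, Lplus F -> hom F G = hom F H.

(** ** The logic *)

(* First-order formulae over the edge relation, with variables named by natural
   numbers and counting quantifiers over tuples of variables. *)
Inductive formula :=
| FEq (x y : nat)
| FEdge (x y : nat)
| FNot (phi : formula)
| FAnd (phi psi : formula)
| FOr (phi psi : formula)
| FExists (n : nat) (ys : seq nat) (phi : formula).

Fixpoint quantifier_free (phi : formula) : bool :=
  match phi with
  | FEq _ _ | FEdge _ _ => true
  | FNot phi => quantifier_free phi
  | FAnd phi psi | FOr phi psi => quantifier_free phi && quantifier_free psi
  | FExists _ _ _ => false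
  end.

Fixpoint free_vars (phi : formula) : {fset nat} :=
  match phi with
  | FEq x y | FEdge x y => [fset x; y]%fset
  | FNot phi => free_vars phi
  | FAnd phi psi | FOr phi psi => (free_vars phi `|` free_vars psi)%fset
  | FExists _ ys phi => (free_vars phi `\` [fset y in ys])%fset
  end.

(* Assignments are partial so that sentences can be evaluated in the empty
   graph. *)
Definition assign (G : graph) (nu : nat -> option G) (ys : seq nat)
    (a : (size ys).-tuple G) : nat -> option G :=
  fun x => if x \in ys then onth a (index x ys) else nu x.

Fixpoint sat (G : graph) (nu : nat -> option G) (phi : formula) : bool :=
  match phi with
  | FEq x y =>
      match nu x, nu y with Some a, Some b => a == b | _, _ => false end
  | FEdge x y =>
      match nu x, nu y with Some a, Some b => edge a b | _, _ => false end
  | FNot phi => ~~ sat nu phi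
  | FAnd phi psi => sat nu phi && sat nu psi
  | FOr phi psi => sat nu phi || sat nu psi
  | FExists n ys phi =>
      n <= #|[set a : (size ys).-tuple G | sat (assign nu a) phi]|
  end.

(* [Mformula t X phi]: [phi] is a formula of the logic whose 2t free variables
   are the elements of [X]; the quantifier-free formulae need not mention all of
   them. *)
Inductive Mformula (t : nat) : {fset nat} -> formula -> Prop :=
| M_qf (X : {fset nat}) phi :
    #|` X| = t + t -> quantifier_free phi -> (free_vars phi `<=` X)%fset ->
    Mformula t X phi
| M_not X phi : Mformula t X phi -> Mformula t X (FNot phi)
| M_and X phi psi :
    Mformula t X phi -> Mformula t X psi -> Mformula t X (FAnd phi psi)
| M_or X phi psi :
    Mformula t X phi -> Mformula t X psi -> Mformula t X (FOr phi psi)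
| M_exists (n : nat) (x y z : t.-tuple nat) phi psi :
    uniq (x ++ y ++ z) ->
    Mformula t [fset v in x ++ y]%fset phi ->
    Mformula t [fset v in y ++ z]%fset psi ->
    Mformula t [fset v in x ++ z]%fset (FExists n y (FAnd phi psi)).

Inductive Msentence (t : nat) : formula -> Prop :=
| M_sentence (n : nat) (x : (t + t).-tuple nat) phi :
    uniq x -> Mformula t [fset v in (x : seq nat)]%fset phi ->
    Msentence t (FExists n x phi).

Definition models (G : graph) (phi : formula) : Prop :=
  sat (fun _ => None : option G) phi.

Definition same_Msentences (t : nat) (G H : graph) : Prop :=
  forall phi : formula, Msentence t phi -> (models G phi <-> models H phi).

(* Main.v *)
(* Counting homomorphisms with prescribed images of the labels turns parallel
   composition into the pointwise product and series composition into a sum over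
   the middle tuple; the logic behaves in the same way, with indicators of
   definable sets of tuples in place of homomorphism counts.  A value computed by
   such an expression is determined by a finite round of the colouring, because
   two equal colours are matched by a bijection between the middle tuples.
   Conversely, call two tuples similar if all these values agree on them.  The
   linear span of the value functions is closed under products, so it contains a
   nonzero multiple of the indicator of every similarity class; hence the number
   of middle tuples leading to given classes is itself an invariant of
   similarity, and similar tuples have equal colours in every round. *)

Require Import Defs.
From mathcomp Require Import all_boot.
From mathcomp Require Import perm ssralg ssrnum ssrint finmap multiset boolp.

Set Implicit Arguments.
Unset Strict Implicit.
Unset Printing Implicit Defensive.

Import GRing.Theory Num.Theory.
Local Open Scope nat_scope.

(** * Bijections from equal multisets, and permuted tuples *)

Lemma perm_eq_bij (A A' : finType) (K : eqType) (k : A -> K) (k' : A' -> K) :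
  perm_eq [seq k a | a : A] [seq k' a | a : A'] ->
  exists2 f : A -> A', bijective f & forall a, k a = k' (f a).
Proof.
move=> kk'; have eAA' : #|A'| = #|A|.
  by move: (perm_size kk'); rewrite !size_image.
have sz' : size [seq k' a | a : A'] == #|A|.
  by rewrite size_image eAA'.
have /tuple_permP [p Hp] : perm_eq [seq k a | a : A] (Tuple sz') by [].
(* The list equality only permutes positions, so [f] passes through the ranks in the two
   enumerations. *)
pose f a := enum_val (cast_ord (esym eAA') (p (enum_rank a))).
exists f => [|a].
  exists (fun b => enum_val ((p^-1)%g (cast_ord eAA' (enum_rank b)))) => a.
    by rewrite /f enum_valK cast_ordKV permK enum_rankK.
  by rewrite /f enum_valK permKV cast_ordK enum_rankK.
have := congr1 (fun s => nth (k a) s (enum_rank a)) Hp.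
rewrite (nth_map a) -?cardE // nth_enum_rank => ->.
rewrite (nth_map (enum_rank a)) -?cardE ?card_ord //.
rewrite nth_ord_enum (tnth_nth (k a)) /= (nth_map (f a)) -?cardE ?eAA' //.
by congr (k' _); rewrite [RHS](enum_val_nth (f a)).
Qed.

Lemma bij_perm_eq (A A' : finType) (K : eqType) (k : A -> K) (k' : A' -> K)
    (f : A -> A') : bijective f -> (forall a, k a = k' (f a)) ->
  perm_eq [seq k a | a : A] [seq k' a | a : A'].
Proof.
move=> bf kf; have -> : [seq k a | a : A] = map k' (map f (enum A)).
  by rewrite -map_comp; apply: eq_map.
apply: perm_map; apply: uniq_perm.
- by rewrite map_inj_uniq ?enum_uniq //; apply: bij_inj.
- exact: enum_uniq.
- by case: bf => g fK gK b; rewrite mem_enum -[b]gK map_f ?mem_enum.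
Qed.

Section Tuples.

Variables (T : Type) (t : nat).

Lemma ltup_cat (x y : t.-tuple T) : ltup (cat_tuple x y) = x.
Proof. by apply: eq_from_tnth => i; rewrite tnth_mktuple tnth_lshift. Qed.

Lemma rtup_cat (x y : t.-tuple T) : rtup (cat_tuple x y) = y.
Proof. by apply: eq_from_tnth => i; rewrite tnth_mktuple tnth_rshift. Qed.

Lemma cat_ltup_rtup (x : (t + t).-tuple T) : cat_tuple (ltup x) (rtup x) = x.
Proof.
apply: eq_from_tnth => i; rewrite -[i]splitK; case: (split i) => j /=.
  by rewrite tnth_lshift tnth_mktuple.
by rewrite tnth_rshift tnth_mktuple.
Qed.

Lemma permt1 n (x : n.-tuple T) : permt 1 x = x.
Proof. by apply: eq_from_tnth => i; rewrite tnth_mktuple perm1. Qed.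

Lemma permtM n (s u : 'S_n) (x : n.-tuple T) :
  permt s (permt u x) = permt (s * u)%g x.
Proof. by apply: eq_from_tnth => i; rewrite !tnth_mktuple permM. Qed.

Lemma permtK n (s : 'S_n) : cancel (@permt T n s) (permt s^-1).
Proof. by move=> x; rewrite permtM mulVg permt1. Qed.

Lemma permtVK n (s : 'S_n) : cancel (@permt T n s^-1) (permt s).
Proof. by move=> x; rewrite permtM mulgV permt1. Qed.

End Tuples.

Lemma permt_map (T U : Type) n (s : 'S_n) (h : T -> U) (x : n.-tuple T) :
  map_tuple h (permt s x) = permt s (map_tuple h x).
Proof. by apply: eq_from_tnth => i; rewrite !(tnth_map, tnth_mktuple). Qed.

(** * The colour refinement as a bijective game *)

Section Refinement.

Variables (t : nat) (G H : graph).
Implicit Types (x : (t + t).-tuple G) (y : (t + t).-tuple H).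

Lemma mwl_half x y i : mwl i.+1 x = mwl i.+1 y ->
  forall s, mwl i (permt s x) = mwl i (permt s y).
Proof. by case=> /ffunP h _ s; have := h s; rewrite !ffunE. Qed.

Lemma mwlW x y i : mwl i.+1 x = mwl i.+1 y -> mwl i x = mwl i y.
Proof. by move/mwl_half => /(_ 1%g); rewrite !permt1. Qed.

Lemma mwl_leq x y i j : i <= j -> mwl j x = mwl j y -> mwl i x = mwl i y.
Proof.
move=> /subnKC <-; elim: (j - i) => [|k IH]; first by rewrite addn0.
by rewrite addnS => /mwlW.
Qed.

(** Equal multisets of pairs are matched by a bijection of the middle tuples; the identity component
    of each half-round colour then gives the colours of the unpermuted tuples. *)
Lemma mwl_game x y i : mwl i.+1 x = mwl i.+1 y ->
  exists2 f : t.-tuple G -> t.-tuple H, bijective f & forall w,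
    mwl i (cat_tuple (ltup x) w) = mwl i (cat_tuple (ltup y) (f w)) /\
    mwl i (cat_tuple w (rtup x)) = mwl i (cat_tuple (f w) (rtup y)).
Proof.
case=> _ /eq_seq_msetP /perm_eq_bij [f bf hf]; exists f => // w.
case: (hf w) => /ffunP /(_ 1%g) + /ffunP /(_ 1%g).
by rewrite !ffunE !permt1.
Qed.

(** Coinduction for the stable colouring: [R] supplies everything one round inspects and is
    re-established for the tuples reached, so induction on the round works for all related pairs at
    once. *)
Lemma mwl_bisim (R : (t + t).-tuple G -> (t + t).-tuple H -> Prop) :
  (forall x y, R x y -> atp x = atp y) ->
  (forall x y s, R x y -> R (permt s x) (permt s y)) ->
  (forall x y, R x y -> exists2 f : t.-tuple G -> t.-tuple H, bijective f &
     forall w, R (cat_tuple (ltup x) w) (cat_tuple (ltup y) (f w)) /\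
               R (cat_tuple w (rtup x)) (cat_tuple (f w) (rtup y))) ->
  forall x y, R x y -> mwl_infty_eq x y.
Proof.
move=> Ratp Rperm Rgame x y Rxy i; elim: i x y Rxy => [|i IH] x y Rxy.
  exact: Ratp.
have half x' y' : R x' y' ->
    half_step (@mwl t G i) x' = half_step (@mwl t H i) y'.
  by move=> Rxy'; apply/ffunP => s; rewrite !ffunE; apply/IH/Rperm.
congr pair; first exact: half.
have [f bf hf] := Rgame x y Rxy.
apply/eq_seq_msetP; apply: bij_perm_eq bf _ => w.
by have [h1 h2] := hf w; congr pair; apply: half.
Qed.

End Refinement.

(** Only values that occur are compared; in the applications each is therefore the class of an
    actual tuple. *)
Lemma perm_eq_card_fibre (A A' : finType) (K : eqType) (k : A -> K) (k' : A' -> K) :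
  (forall c, c \in [seq k a | a : A] ++ [seq k' a | a : A'] ->
     #|[set a | k a == c]| = #|[set a | k' a == c]|) ->
  perm_eq [seq k a | a : A] [seq k' a | a : A'].
Proof.
have count_fibre (B : finType) (l : B -> K) c :
    count_mem c [seq l b | b : B] = #|[set b | l b == c]|.
  by rewrite count_map -sum1_count big_enum_cond sum1dep_card.
move=> kk'; apply/allP => c /kk' eq_c.
by rewrite /= !count_fibre eq_c.
Qed.

Lemma sumr_card (A : finType) (P : pred A) :
  (\sum_a (P a)%:R = #|[set a | P a]|%:R :> int)%R.
Proof. by rewrite -natr_sum -sum1dep_card [in RHS]big_mkcond. Qed.

(** * Separating tuples by a family of value functions *)

Section Separation.

Variables (t : nat) (I : finType) (Gs : I -> graph).

Local Open Scope ring_scope.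

(** One function on each graph of the family, so that a single valuation compares tuples of
    different graphs. Integer values allow the subtractions that build indicators. *)
Definition valuation := forall i, (t + t).-tuple (Gs i) -> int.

Implicit Types f g : valuation.

Definition val_mul f g : valuation := fun i x => f i x * g i x.
Definition val_perm (s : 'S_(t + t)) f : valuation := fun i x => f i (permt s x).
Definition val_series f g : valuation := fun i x =>
  \sum_(w : t.-tuple (Gs i))
     f i (cat_tuple (ltup x) w) * g i (cat_tuple w (rtup x)).

(** The integral linear span of [B], closed under pointwise equality by [span_ext]. *)
Inductive span (B : valuation -> Prop) : valuation -> Prop :=
| span_gen f : B f -> span B f
| span_add f g : span B f -> span B g -> span B (fun i x => f i x + g i x)
| span_scale a f : span B f -> span B (fun i x => a * f i x)
| span_ext f g : (forall i x, f i x = g i x) -> span B f -> span B g.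

Definition sim (B : valuation -> Prop) i j (x : (t + t).-tuple (Gs i))
    (y : (t + t).-tuple (Gs j)) : Prop :=
  forall f, B f -> f i x = f j y.

Lemma span_sum (B : valuation -> Prop) (J : Type) (r : seq J) (F : J -> valuation) f :
  span B f -> (forall k, span B (F k)) -> span B (fun i x => \sum_(k <- r) F k i x).
Proof.
move=> Bf BF; elim: r => [|k r IH].
  (* The empty sum is obtained as the zero multiple of the given [f]. *)
  by apply: (span_ext _ (span_scale 0 Bf)) => i x; rewrite big_nil mul0r.
by apply: (span_ext _ (span_add (BF k) IH)) => i x; rewrite big_cons.
Qed.

(** The closure conditions concern generators and land only in the span: for definable predicates a
    series composition is a number of witnesses, not an indicator. [Bsum] is where the assumed
    equivalence of the graphs enters. *)
Variable B : valuation -> Prop.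
Hypothesis B1 : span B (fun _ _ => 1).
Hypothesis BM : forall f g, B f -> B g -> span B (val_mul f g).
Hypothesis Bperm : forall s f, B f -> span B (val_perm s f).
Hypothesis Bseries : forall f g, B f -> B g -> span B (val_series f g).
Hypothesis Bsum : forall f i j, B f -> \sum_x f i x = \sum_y f j y.
Hypothesis Batp : forall i j (x : (t + t).-tuple (Gs i)) (y : (t + t).-tuple (Gs j)),
  sim B x y -> atp x = atp y.

(** Nested induction on the two span derivations reduces a bilinear operation to its values on
    generators. *)
Lemma span_bilinear (op : valuation -> valuation -> valuation) :
  (forall f1 f2 g i x, op (fun i x => f1 i x + f2 i x) g i x = op f1 g i x + op f2 g i x) ->
  (forall f g1 g2 i x, op f (fun i x => g1 i x + g2 i x) i x = op f g1 i x + op f g2 i x) ->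
  (forall a f g i x, op (fun i x => a * f i x) g i x = a * op f g i x) ->
  (forall a f g i x, op f (fun i x => a * g i x) i x = a * op f g i x) ->
  (forall f f' g g', (forall i x, f i x = f' i x) -> (forall i x, g i x = g' i x) ->
     forall i x, op f g i x = op f' g' i x) ->
  (forall f g, B f -> B g -> span B (op f g)) ->
  forall f g, span B f -> span B g -> span B (op f g).
Proof.
move=> addl addr scalel scaler ext gen f g Bf; elim: Bf g => {f}.
- move=> f Bf g; elim=> {g} [g||a g _ IH|g g' gg' _ IH].
  + exact: gen.
  + move=> g1 g2 _ IH1 _ IH2.
    by apply: span_ext (span_add IH1 IH2) => i x; rewrite addr.
  + by apply: span_ext (span_scale a IH) => i x; rewrite scaler.
  + by apply: span_ext IH; apply: ext.
- move=> f1 f2 _ IH1 _ IH2 g Bg.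
  by apply: span_ext (span_add (IH1 g Bg) (IH2 g Bg)) => i x; rewrite addl.
- move=> a f _ IH g Bg.
  by apply: span_ext (span_scale a (IH g Bg)) => i x; rewrite scalel.
- by move=> f f' ff' _ IH g Bg; apply: span_ext (IH g Bg); apply: ext.
Qed.

Lemma span_mul f g : span B f -> span B g -> span B (val_mul f g).
Proof.
apply: span_bilinear => //= *; rewrite /val_mul.
- exact: mulrDl.
- exact: mulrDr.
- by rewrite mulrA.
- exact: mulrCA.
- by congr (_ * _).
Qed.

Lemma span_series f g : span B f -> span B g -> span B (val_series f g).
Proof.
apply: span_bilinear => //= *; rewrite /val_series ?mulr_sumr -?big_split /=;
  apply: eq_bigr => w _.
- exact: mulrDl.
- exact: mulrDr.
- by rewrite mulrA.
- exact: mulrCA.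
- by congr (_ * _).
Qed.

Lemma span_sim f i j (x : (t + t).-tuple (Gs i)) (y : (t + t).-tuple (Gs j)) :
  span B f -> sim B x y -> f i x = f j y.
Proof.
move=> + xy; elim=> {f} [f||a f _ ->|f f' ff' _ ] //; first exact: xy.
- by move=> f g _ -> _ ->.
- by rewrite !ff'.
Qed.

Lemma span_total f i j : span B f -> \sum_x f i x = \sum_y f j y.
Proof.
elim=> {f} [f||a f _ IH|f f' ff' _ ]; first exact: Bsum.
- by move=> f g _ IHf _ IHg; rewrite !big_split IHf IHg.
- by rewrite -!mulr_sumr IH.
- by under eq_bigr do rewrite ff'; under [RHS]eq_bigr do rewrite ff'.
Qed.

(** All tuples of all graphs together. The type is finite, so an indicator can be built as a finite
    product over it. *)
Definition point : finType := {i : I & (t + t).-tuple (Gs i)}.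

Definition psim (p q : point) : Prop := sim B (tagged p) (tagged q).

Lemma psim_refl p : psim p p. Proof. by []. Qed.

Lemma psim_sym p q : psim p q -> psim q p.
Proof. by move=> pq f /pq. Qed.

Lemma psim_trans p q r : psim p q -> psim q r -> psim p r.
Proof. by move=> pq qr f Bf; rewrite (pq f Bf) (qr f Bf). Qed.

(* The product, over the points [q] inequivalent to [p], of [f_q - f_q q] with
   [f_q] separating [p] from [q]. *)
Lemma indicator (p : point) : exists g, [/\ span B g, g _ (tagged p) != 0 &
  forall q : point, ~ psim p q -> g _ (tagged q) = 0].
Proof.
suff [g [Bg gp gq]] : exists g, [/\ span B g, g _ (tagged p) != 0 &
    forall q, q \in enum point -> ~ psim p q -> g _ (tagged q) = 0].
  by exists g; split=> // q; apply: gq; rewrite mem_enum.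
elim: (enum point) => [|q s [g [Bg gp gs]]]; first by exists (fun _ _ => 1).
have [pq|npq] := pselect (psim p q).
  by exists g; split=> // r; rewrite inE => /predU1P[-> //|]; apply: gs.
have [f [Bf fpq]] : exists f, B f /\ f _ (tagged p) <> f _ (tagged q).
  apply: contrapT => nf; apply: npq => f Bf; apply: contrapT => fpq.
  by apply: nf; exists f.
pose h : valuation := fun i x => f i x + - f _ (tagged q) * 1.
have Bh : span B h by apply: span_add; [apply: span_gen | apply: span_scale].
exists (val_mul g h); split; first exact: span_mul.
  rewrite /val_mul mulf_neq0 // /h mulr1 subr_eq0; exact/eqP.
move=> r; rewrite inE => /predU1P[-> _|rs npr].
  by rewrite /val_mul /h mulr1 subrr mulr0.
by rewrite /val_mul gs // mul0r.
Qed.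

(** Classes as finite sets turn the propositional relation [psim] into a colour with decidable
    equality that is comparable across graphs. *)
Definition sim_class (p : point) : {set point} := [set q | `[< psim p q >]].

Lemma sim_classP p q : reflect (psim p q) (sim_class p == sim_class q).
Proof.
apply: (iffP eqP) => [/setP /(_ q)|pq].
  by rewrite !inE (asboolT (psim_refl q)) => /asboolP.
apply/setP => r; rewrite !inE; apply/asboolP/asboolP.
  exact: psim_trans (psim_sym pq).
exact: psim_trans.
Qed.

Definition tclass i (x : (t + t).-tuple (Gs i)) : {set point} :=
  sim_class (Tagged (fun i => (t + t).-tuple (Gs i)) x).

(** The function [g] of [indicator] is constant on the class of [p], because span members respect
    similarity, and zero outside it. The integers offer no division, so the factor [a] stays; being
    nonzero, it cancels later. *)
Lemma indicatorE (p : point) : exists a g, [/\ a != 0, span B g &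
  forall i (x : (t + t).-tuple (Gs i)), g i x = a * (tclass x == sim_class p)%:R].
Proof.
have [g [Bg gp gq]] := indicator p; exists (g _ (tagged p)), g; split=> // i x.
pose q : point := Tagged (fun i => (t + t).-tuple (Gs i)) x.
rewrite eq_sym; case: (sim_classP p q) => [/(span_sim Bg) <-|/gq] /=.
  by rewrite mulr1.
by rewrite mulr0.
Qed.

Lemma sim_perm i j (x : (t + t).-tuple (Gs i)) (y : (t + t).-tuple (Gs j)) s :
  sim B x y -> sim B (permt s x) (permt s y).
Proof. by move=> xy f /(Bperm s) /span_sim /(_ xy). Qed.

(** The total of a multiple of the class indicator is that multiple of the class size, and totals
    agree across the graphs. *)
Lemma card_class i j (p : point) :
  #|[set x : (t + t).-tuple (Gs i) | tclass x == sim_class p]| =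
  #|[set y : (t + t).-tuple (Gs j) | tclass y == sim_class p]|.
Proof.
have [a [g [a0 Bg gE]]] := indicatorE p.
have := span_total i j Bg.
under eq_bigr do rewrite gE; under [RHS]eq_bigr do rewrite gE.
rewrite -!mulr_sumr => /(mulfI a0).
by rewrite !sumr_card => /eqP; rewrite eqr_nat => /eqP.
Qed.

(** The series composition of two class indicators counts, up to the factor [a * b], the middle
    tuples that lead to both classes; as a span member it takes equal values at [x] and [y]. *)
Lemma card_class2 i j (x : (t + t).-tuple (Gs i)) (y : (t + t).-tuple (Gs j))
    (p q : point) : sim B x y ->
  #|[set w : t.-tuple (Gs i) |
      (tclass (cat_tuple (ltup x) w), tclass (cat_tuple w (rtup x))) ==
      (sim_class p, sim_class q)]| =
  #|[set w : t.-tuple (Gs j) |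
      (tclass (cat_tuple (ltup y) w), tclass (cat_tuple w (rtup y))) ==
      (sim_class p, sim_class q)]|.
Proof.
move=> xy; have [a [g [a0 Bg gE]]] := indicatorE p.
have [b [h [b0 Bh hE]]] := indicatorE q.
have := span_sim (span_series Bg Bh) xy; rewrite /val_series.
under eq_bigr do rewrite gE hE mulrACA -natrM mulnb.
under [RHS]eq_bigr do rewrite gE hE mulrACA -natrM mulnb.
rewrite -!mulr_sumr => /(mulfI (mulf_neq0 a0 b0)).
by rewrite !sumr_card => /eqP; rewrite eqr_nat => /eqP.
Qed.

(** Matching classes of equal size gives the outer bijection. Similarity then serves as the relation
    of [mwl_bisim], with game bijections obtained from [card_class2]. *)
Lemma separation_mwl i j : mwl_not_distinguished t (Gs i) (Gs j).
Proof.
have classP k l (x : (t + t).-tuple (Gs k)) (y : (t + t).-tuple (Gs l)) :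
    tclass x = tclass y -> sim B x y.
  by move=> /eqP /sim_classP.
have [f bf hf] : exists2 f : (t + t).-tuple (Gs i) -> (t + t).-tuple (Gs j),
    bijective f & forall x, tclass x = tclass (f x).
  apply/perm_eq_bij/perm_eq_card_fibre => c; rewrite mem_cat.
  by case/orP=> /imageP [x _ ->]; apply: card_class.
exists f => // x; apply: (@mwl_bisim _ _ _ (@sim B i j)) (classP _ _ _ _ (hf x)).
- exact: Batp.
- by move=> ? ? s; apply: sim_perm.
move=> {f bf hf}{}x y xy.
have [f bf hf] : exists2 f : t.-tuple (Gs i) -> t.-tuple (Gs j),
    bijective f & forall w,
      (tclass (cat_tuple (ltup x) w), tclass (cat_tuple w (rtup x))) =
      (tclass (cat_tuple (ltup y) (f w)), tclass (cat_tuple (f w) (rtup y))).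
  apply/(@perm_eq_bij _ _ _ _
    (fun w => (tclass (cat_tuple (ltup y) w), tclass (cat_tuple w (rtup y))))).
  apply/perm_eq_card_fibre => c; rewrite mem_cat.
  by case/orP=> /imageP [w _ ->]; apply: card_class2.
by exists f => // w; case: (hf w) => /classP ? /classP.
Qed.

End Separation.

(** * Labelled homomorphism counts *)

Definition is_hom (F G : graph) (h : {ffun F -> G}) : bool :=
  [forall x, forall y, edge x y ==> edge (h x) (h y)].

Lemma is_homP (F G : graph) (h : {ffun F -> G}) :
  reflect (forall x y, edge x y -> edge (h x) (h y)) (is_hom h).
Proof.
apply: (iffP forallP) => [hh x y|hh x].
  by move: (hh x) => /forallP /(_ y) /implyP.
by apply/forallP => y; apply/implyP/hh.
Qed.

Definition lhom (t : nat) (F : bilabelled t) (G : graph) (x : (t + t).-tuple G) : nat :=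
  #|[set h : {ffun F -> G} | is_hom h && (map_tuple h (labels F) == x)]|.

Lemma sum_lhom (t : nat) (F : bilabelled t) (G : graph) :
  hom F G = \sum_(x : (t + t).-tuple G) lhom F x.
Proof.
rewrite /hom -sum1_card (partition_big (fun h : {ffun F -> G} => map_tuple h (labels F)) predT) //=.
apply: eq_bigr => x _; rewrite /lhom -sum1dep_card.
by apply: eq_bigl => h; rewrite inE.
Qed.

Lemma cls_eq (G : graph) (ps : seq (G * G)) x y :
  (x, y) \in ps -> cls ps x = cls ps y.
Proof.
move=> xy; apply: val_inj; apply/(fingraph.rootP (@glue_connect_sym _ ps)).
by apply: connect1; rewrite /glue xy.
Qed.

Section Glued.

Variables (t n : nat) (F F' : bilabelled t) (u : n.-tuple F) (v : n.-tuple F').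
Variable K : graph.
Variable Q : {ffun F -> K} -> {ffun F' -> K} -> bool.

Let U := disjoint_union F F'.
Let ps : seq (U * U) := zip (map inl u) (map inr v).

Definition copair (h : {ffun F -> K}) (h' : {ffun F' -> K}) (a : U) : K :=
  match a with inl x => h x | inr y => h' y end.

(** The combined map agrees on each glued pair, hence along every [glue]-path, in particular the
    path from a vertex to its root. *)
Lemma copair_root (h : {ffun F -> K}) (h' : {ffun F' -> K}) : map_tuple h u = map_tuple h' v ->
  forall a, copair h h' (root (glue ps) a) = copair h h' a.
Proof.
move=> huv; pose k := copair h h'.
have psE p : p \in ps -> k p.1 = k p.2.
  case: p => c d /(nthP (c, d)) [i lt_i <-]; move: lt_i.
  rewrite size_zip !size_map !size_tuple minnn => lt_i.
  rewrite nth_zip ?size_map ?size_tuple //=.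
  have := congr1 (fun x : n.-tuple K => tnth x (Ordinal lt_i)) huv.
  rewrite !tnth_map (tnth_nth (tnth u (Ordinal lt_i))) (tnth_nth (tnth v (Ordinal lt_i))) /=.
  rewrite (nth_map (tnth u (Ordinal lt_i))) ?size_tuple //.
  by rewrite (nth_map (tnth v (Ordinal lt_i))) ?size_tuple.
move=> a; have /connectP [p ap ->] := connect_root (glue ps) a.
elim: p a ap => [|b p IH] a //= /andP[ab bp]; rewrite (IH b bp).
by case/orP: ab => /psE.
Qed.

(** Restriction to the two sides is injective, and its image consists of the pairs of homomorphisms
    that agree on the glued labels. The side condition [Q] is left arbitrary so that series and
    parallel composition are both covered. *)
Lemma card_glued :
  #|[set h : {ffun glued u v -> K} | is_hom h &&
      Q [ffun x => h (glued_inl u v x)] [ffun y => h (glued_inr u v y)]]| =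
  #|[set p : {ffun F -> K} * {ffun F' -> K} |
      [&& is_hom p.1, is_hom p.2, map_tuple p.1 u == map_tuple p.2 v & Q p.1 p.2]]|.
Proof.
pose restr (h : {ffun glued u v -> K}) :=
  ([ffun x => h (glued_inl u v x)], [ffun y => h (glued_inr u v y)]).
have clsK (a : glued u v) : cls ps (val a) = a.
  by apply: val_inj => /=; apply/eqP; case: a.
have restr_inj : injective restr.
  move=> h1 h2 [/ffunP e1 /ffunP e2]; apply/ffunP => a; rewrite -[a]clsK.
  case: (val a) => [x|y]; first by have := e1 x; rewrite !ffunE.
  by have := e2 y; rewrite !ffunE.
have cls_uv i : glued_inl u v (tnth u i) = glued_inr u v (tnth v i).
  apply: cls_eq.
  pose d : U := inl (tnth u i).
  apply/(nthP (d, d)); exists i.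
    by rewrite size_zip !size_map !size_tuple minnn.
  rewrite nth_zip ?size_map ?size_tuple //.
  rewrite (nth_map (tnth u i)) ?size_tuple // (nth_map (tnth v i)) ?size_tuple //.
  by rewrite -!tnth_nth.
rewrite -(card_imset _ restr_inj); apply: eq_card => -[h1 h2].
rewrite [in RHS]inE /=; apply/imsetP/and4P => [[h]|[hom1 hom2 /eqP h12 Q12]].
  rewrite inE => /andP[/is_homP hom_h Qh] [-> ->]; split=> //.
  - apply/is_homP => x y xy; rewrite !ffunE; apply: hom_h.
    by apply/existsP; exists (inl x); apply/existsP; exists (inl y); rewrite !eqxx.
  - apply/is_homP => x y xy; rewrite !ffunE; apply: hom_h.
    by apply/existsP; exists (inr x); apply/existsP; exists (inr y); rewrite !eqxx.
  - by apply/eqP/eq_from_tnth => i; rewrite !tnth_map !ffunE cls_uv.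
pose k := copair h1 h2.
have kE := copair_root h12.
(* The map on the quotient is read off at canonical representatives; [kE] makes every other
   representative give the same value. *)
pose h := [ffun a : glued u v => k (val a)].
have hr : (h1, h2) = restr h.
  by congr pair; apply/ffunP => x; rewrite !ffunE /k /= kE.
exists h => //; rewrite inE; case: (hr) => <- <-; rewrite Q12 andbT.
apply/is_homP => a b /existsP[c /existsP[d /and3P[/eqP <- /eqP <- cd]]].
rewrite !ffunE /k /= !kE.
by case: c d cd => [c|c] [d|d] //=; [apply: (is_homP _ hom1) | apply: (is_homP _ hom2)].
Qed.

End Glued.

Lemma labels_perm (t : nat) s (F : bilabelled t) :
  labels (perm_labels s F) = permt s (labels F).
Proof. exact: cat_ltup_rtup. Qed.

Lemma lhom_perm (t : nat) s (F : bilabelled t) (G : graph) (x : (t + t).-tuple G) :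
  lhom (perm_labels s F) x = lhom F (permt s^-1 x).
Proof.
apply: eq_card => h; rewrite !inE labels_perm permt_map; congr (_ && _).
by apply/eqP/eqP => [<-|->]; rewrite ?permtK ?permtVK.
Qed.

Lemma map_ltup (t : nat) (A C : Type) (h : A -> C) (x : (t + t).-tuple A) :
  map_tuple h (ltup x) = ltup (map_tuple h x).
Proof. by apply: eq_from_tnth => i; rewrite !(tnth_map, tnth_mktuple). Qed.

Lemma map_rtup (t : nat) (A C : Type) (h : A -> C) (x : (t + t).-tuple A) :
  map_tuple h (rtup x) = rtup (map_tuple h x).
Proof. by apply: eq_from_tnth => i; rewrite !(tnth_map, tnth_mktuple). Qed.

Lemma eq_ltup_rtup (t : nat) (A : eqType) (x y : (t + t).-tuple A) :
  (x == y) = (ltup x == ltup y) && (rtup x == rtup y).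
Proof.
apply/eqP/andP => [-> //|[/eqP l /eqP r]].
by rewrite -[x]cat_ltup_rtup -[y]cat_ltup_rtup l r.
Qed.

Lemma map_labels (t : nat) (F : bilabelled t) (A : eqType) (h : F -> A) (x : (t + t).-tuple A) :
  (map_tuple h (labels F) == x) =
  (map_tuple h (in_lab F) == ltup x) && (map_tuple h (out_lab F) == rtup x).
Proof. by rewrite eq_ltup_rtup -map_ltup -map_rtup ltup_cat rtup_cat. Qed.

Lemma lhom_parallel (t : nat) (F F' : bilabelled t) (G : graph) (x : (t + t).-tuple G) :
  lhom (parallel F F') x = lhom F x * lhom F' x.
Proof.
rewrite /lhom -cardsX.
transitivity #|[set h : {ffun glued (labels F) (labels F') -> G} | is_hom h &&
   (map_tuple [ffun v => h (glued_inl (labels F) (labels F') v)] (labels F) == x)]|.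
  apply: eq_card => h; rewrite !inE; congr (_ && _); rewrite [in RHS]map_labels map_labels.
  by congr (_ && _); congr (_ == _); apply: eq_from_tnth => i; rewrite !tnth_map ffunE.
rewrite (card_glued _ _ (fun h h' => map_tuple h (labels F) == x)).
apply: eq_card => -[h h']; rewrite !inE /=; case: (is_hom h) => //=; case: (is_hom h') => /=.
  by rewrite andbC; case: eqP => // ->; rewrite eq_sym.
by rewrite andbF.
Qed.

Lemma lhom_series (t : nat) (F F' : bilabelled t) (G : graph) (x : (t + t).-tuple G) :
  lhom (series F F') x =
  \sum_(w : t.-tuple G) lhom F (cat_tuple (ltup x) w) * lhom F' (cat_tuple w (rtup x)).
Proof.
transitivity #|[set h : {ffun glued (out_lab F) (in_lab F') -> G} | is_hom h &&
   ((map_tuple [ffun v => h (glued_inl (out_lab F) (in_lab F') v)] (in_lab F) == ltup x) &&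
    (map_tuple [ffun v => h (glued_inr (out_lab F) (in_lab F') v)] (out_lab F') == rtup x))]|.
  apply: eq_card => h; rewrite !inE; congr (_ && _); rewrite map_labels.
  by congr (_ && _); congr (_ == _); apply: eq_from_tnth => i; rewrite !tnth_map ffunE.
rewrite (card_glued _ _ (fun h h' => (map_tuple h (in_lab F) == ltup x) &&
   (map_tuple h' (out_lab F') == rtup x))).
rewrite -sum1dep_card.
rewrite (partition_big (fun p : {ffun F -> G} * {ffun F' -> G} =>
   map_tuple p.1 (out_lab F)) predT) //=.
apply: eq_bigr => w _; rewrite /lhom -cardsX sum1dep_card.
apply: eq_card => -[h h']; rewrite !inE /= !map_labels !ltup_cat !rtup_cat.
case: (is_hom h) => //=; case: (is_hom h') => /=; last by rewrite andbF.
case: (map_tuple h (in_lab F) == ltup x); rewrite ?andbF //=.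
case: (map_tuple h' (out_lab F') == rtup x); rewrite ?andbF //= !andbT.
by rewrite andbC; case: eqP => // ->; rewrite eq_sym.
Qed.

(** Every vertex carries a label, so [x] determines the homomorphism: the count is 1 if [x] respects
    the equalities and edges of the labels, and 0 otherwise. *)
Lemma lhom_atomic (t : nat) (F : bilabelled t) (G : graph) (x : (t + t).-tuple G) :
  atomic F -> lhom F x =
  [forall i, forall j,
     ((tnth (labels F) i == tnth (labels F) j) ==> (tnth x i == tnth x j)) &&
     (edge (tnth (labels F) i) (tnth (labels F) j) ==> edge (tnth x i) (tnth x j))].
Proof.
move=> atF; set b := [forall i, _].
have labP (v : F) : exists i, v == tnth (labels F) i.
  by have /tnthP [i ->] := atF v; exists i.
have [/forallP bT|bF] := boolP b; last first.
  apply/eqP; rewrite cards_eq0 -subset0; apply/subsetP => h.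
  rewrite inE => /andP[/is_homP hom_h /eqP hx]; case/negP: bF.
  apply/forallP => i; apply/forallP => j; rewrite -hx !tnth_map.
  by apply/andP; split; apply/implyP; [move/eqP-> | apply: hom_h].
(* Any position labelling [v] will do, since [bT] forces [x] to agree at positions with equal
   labels. *)
pose idx (v : F) := xchoose (labP v).
have idxP v : v = tnth (labels F) (idx v) := eqP (xchooseP (labP v)).
pose h := [ffun v : F => tnth x (idx v)].
have bE i j : _ := forallP (bT i) j.
have hx : map_tuple h (labels F) = x.
  apply: eq_from_tnth => i; rewrite tnth_map ffunE; apply/eqP.
  by case/andP: (bE (idx (tnth (labels F) i)) i) => /implyP + _; apply; rewrite -idxP.
rewrite -[RHS](cards1 h); apply: eq_card => k; rewrite !inE.
apply/andP/eqP => [[_ /eqP kx]|->].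
  by apply/ffunP => v; rewrite ffunE -kx tnth_map -idxP.
rewrite hx eqxx; split=> //; apply/is_homP => v w vw; rewrite !ffunE.
by case/andP: (bE (idx v) (idx w)) => _ /implyP; apply; rewrite -!idxP.
Qed.

(** The round depends on [F] alone. Parallel composition takes the later of two rounds; series
    composition and label permutation each cost one further round. *)
Lemma lhom_mwl (t : nat) (F : bilabelled t) : Lplus F ->
  exists i, forall (G H : graph) (x : (t + t).-tuple G) (y : (t + t).-tuple H),
    mwl i x = mwl i y -> lhom F x = lhom F y.
Proof.
elim=> {F} [F atF|F F' _ [i hi] _ [i' hi']|F F' _ [i hi] _ [i' hi']|s F _ [i hi]].
- exists 0 => G H x y /ffunP xy; rewrite !lhom_atomic //.
  congr nat_of_bool; apply: eq_forallb => i; apply: eq_forallb => j.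
  by have := xy (i, j); rewrite !ffunE => -[/= -> ->].
- exists (maxn i i') => G H x y xy; rewrite !lhom_parallel.
  by congr (_ * _); [apply: hi | apply: hi']; apply: mwl_leq xy;
    rewrite (leq_maxl, leq_maxr).
(* The game bijection reindexes the sum over the middle tuple so that corresponding summands
   agree. *)
- exists (maxn i i').+1 => G H x y /mwl_game [f bf hf]; rewrite !lhom_series.
  rewrite [RHS](reindex f); last exact: onW_bij.
  apply: eq_bigr => w _; have [h1 h2] := hf w.
  congr (_ * _); [apply/hi; move: h1 | apply/hi'; move: h2];
    by apply: mwl_leq; rewrite (leq_maxl, leq_maxr).
- exists i.+1 => G H x y /mwl_half /(_ s^-1%g) xy; rewrite !lhom_perm; exact: hi.
Qed.

Lemma mwl_hom (t : nat) (G H : graph) :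
  mwl_not_distinguished t G H -> hom_indistinguishable_Lplus t G H.
Proof.
move=> [f bf hf] F /lhom_mwl [i hi]; rewrite !sum_lhom.
rewrite [RHS](reindex f); last exact: onW_bij.
by apply: eq_bigr => x _; apply/hi/hf.
Qed.

(** * From homomorphism counts to colours *)

Lemma no_edge_sym (T : Type) : symmetric (fun _ _ : T => false).
Proof. by []. Qed.

(** With distinct labels and no edges it imposes no constraint, which supplies the constant
    valuation 1. *)
Definition discrete (t : nat) : bilabelled t :=
  @Bilabelled t (Graph (@no_edge_sym 'I_(t + t)))
    (ltup (ord_tuple (t + t))) (rtup (ord_tuple (t + t))).

Lemma labels_discrete t : labels (discrete t) = ord_tuple (t + t).
Proof. exact: cat_ltup_rtup. Qed.

Lemma discrete_atomic t : atomic (discrete t).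
Proof. by move=> v; rewrite labels_discrete -[v]tnth_ord_tuple mem_tnth. Qed.

Lemma lhom_discrete t (G : graph) (x : (t + t).-tuple G) : lhom (discrete t) x = 1.
Proof.
rewrite lhom_atomic ?labels_discrete; last exact: discrete_atomic.
apply/eqP; rewrite eqb1; apply/forallP => i; apply/forallP => j; rewrite !tnth_ord_tuple andbT.
by apply/implyP => /eqP ->.
Qed.

Section Induced.

Variables (t : nat) (G : graph) (x : (t + t).-tuple G).

Let V : finType := {v : G | v \in x}.

Lemma induced_edge_sym : symmetric (fun a b : V => edge (val a) (val b)).
Proof. by move=> a b; rewrite edge_sym. Qed.

Let lab : (t + t).-tuple V := [tuple (exist _ (tnth x i) (mem_tnth i x) : V) | i < t + t].

(** The subgraph induced on the entries of [x], labelled by [x]: its labelled count at [y] tests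
    whether [y] satisfies every equality and every adjacency that holds in [x]. *)
Definition induced : bilabelled t :=
  @Bilabelled t (Graph induced_edge_sym) (ltup lab) (rtup lab).

Lemma labels_induced i : val (tnth (labels induced) i) = tnth x i.
Proof. by rewrite /labels cat_ltup_rtup tnth_mktuple. Qed.

Lemma induced_atomic : atomic induced.
Proof.
move=> v; have /tnthP [i vi] := valP v.
have -> : v = tnth (labels induced) i by apply: val_inj; rewrite labels_induced.
exact: mem_tnth.
Qed.

Lemma lhom_induced (H : graph) (y : (t + t).-tuple H) : lhom induced y =
  [forall i, forall j, ((tnth x i == tnth x j) ==> (tnth y i == tnth y j)) &&
     (edge (tnth x i) (tnth x j) ==> edge (tnth y i) (tnth y j))].
Proof.
rewrite lhom_atomic; last exact: induced_atomic.
congr nat_of_bool; apply: eq_forallb => i; apply: eq_forallb => j.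
by rewrite -!(labels_induced).
Qed.

Lemma lhom_induced_self : lhom induced x = 1.
Proof.
rewrite lhom_induced; apply/eqP; rewrite eqb1.
by apply/forallP => i; apply/forallP => j; rewrite !implybb.
Qed.

End Induced.

(** The graphs induced by [x] and by [y] give the two directions of each equivalence in the atomic
    type. *)
Lemma lhom_atp (t : nat) (G H : graph) (x : (t + t).-tuple G) (y : (t + t).-tuple H) :
  (forall F : bilabelled t, Lplus F -> lhom F x = lhom F y) -> atp x = atp y.
Proof.
move=> xy.
have := xy _ (Lplus_atomic (@induced_atomic _ _ x)).
rewrite lhom_induced_self lhom_induced; case: forallP => // xy1 _.
have := xy _ (Lplus_atomic (@induced_atomic _ _ y)).
rewrite lhom_induced_self lhom_induced; case: forallP => // yx1 _.
apply/ffunP => -[i j]; rewrite !ffunE /=.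
have /andP[/implyP e1 /implyP d1] := forallP (xy1 i) j.
have /andP[/implyP e2 /implyP d2] := forallP (yx1 i) j.
by congr pair; apply/idP/idP.
Qed.

Lemma hom_mwl (t : nat) (G H : graph) :
  hom_indistinguishable_Lplus t G H -> mwl_not_distinguished t G H.
Proof.
move=> GH; pose Gs b := if b then G else H.
pose B (f : valuation t Gs) := exists2 F : bilabelled t, Lplus F &
  forall b x, f b x = (lhom F x)%:R%R.
have lB F : Lplus F -> B (fun b x => (lhom F x)%:R%R) by exists F.
apply: (@separation_mwl t bool Gs B _ _ _ _ _ _ true false).
- apply: (span_ext _ (span_gen (lB _ (Lplus_atomic (@discrete_atomic t))))) => b x.
  by rewrite lhom_discrete.
- move=> f g [F LF fE] [F' LF' gE].
  apply: (span_ext _ (span_gen (lB _ (Lplus_parallel LF LF')))) => b x.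
  by rewrite /val_mul lhom_parallel natrM fE gE.
- move=> s f [F LF fE].
  apply: (span_ext _ (span_gen (lB _ (Lplus_perm s^-1%g LF)))) => b x.
  by rewrite /val_perm lhom_perm invgK fE.
- move=> f g [F LF fE] [F' LF' gE].
  apply: (span_ext _ (span_gen (lB _ (Lplus_series LF LF')))) => b x.
  rewrite /val_series lhom_series natr_sum; apply: eq_bigr => w _.
  by rewrite natrM fE gE.
(* Totals of labelled counts are plain homomorphism counts, so the hypothesis [GH] applies here. *)
- move=> f i j [F LF fE].
  have fsum b : (\sum_(x : (t + t).-tuple (Gs b)) f b x = (hom F G)%:R)%R.
    under eq_bigr do rewrite fE.
    by rewrite -natr_sum -sum_lhom; case: b => //=; rewrite GH.
  by rewrite !fsum.
- move=> i j x y xy; apply: lhom_atp => F LF.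
  by have /eqP := xy _ (lB _ LF); rewrite eqr_nat => /eqP.
Qed.

(** * The logic *)

Definition denotes n (G : graph) (nu : nat -> option G) (v : n.-tuple nat)
    (a : n.-tuple G) : Prop :=
  forall k, nu (tnth v k) = Some (tnth a k).

(* [assign] with an untyped sequence of values, which avoids transporting tuples
   along [size y = n]. *)
Definition update (G : graph) (nu : nat -> option G) (y : seq nat) (a : seq G) :
    nat -> option G :=
  fun z => if z \in y then onth a (index z y) else nu z.

Lemma card_assign n (G : graph) (nu : nat -> option G) (y : n.-tuple nat)
    (Q : pred (nat -> option G)) :
  #|[set a : (size y).-tuple G | Q (assign nu a)]| =
  #|[set w : n.-tuple G | Q (update nu y w)]|.
Proof.
have card_cast m (e : size y = m) (S : pred (seq G)) :
    #|[set a : (size y).-tuple G | S a]| = #|[set w : m.-tuple G | S w]|.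
  by case: m / e.
exact: (card_cast n (size_tuple y) (fun a => Q (update nu y a))).
Qed.

Lemma denotes_permt n (G : graph) nu (v : n.-tuple nat) (a : n.-tuple G) s :
  denotes nu v a -> denotes nu (permt s v) (permt s a).
Proof. by move=> va k; rewrite !tnth_mktuple. Qed.

Lemma denotes_cat m n (G : graph) nu (v : m.-tuple nat) (w : n.-tuple nat)
    (a : m.-tuple G) (b : n.-tuple G) :
  denotes nu v a -> denotes nu w b -> denotes nu (cat_tuple v w) (cat_tuple a b).
Proof.
move=> va wb k; rewrite -[k]splitK; case: (split k) => j /=.
  by rewrite !tnth_lshift.
by rewrite !tnth_rshift.
Qed.

Lemma denotes_ltup t (G : graph) nu (v : (t + t).-tuple nat) (a : (t + t).-tuple G) :
  denotes nu v a -> denotes nu (ltup v) (ltup a).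
Proof. by move=> va k; rewrite !tnth_mktuple. Qed.

Lemma denotes_rtup t (G : graph) nu (v : (t + t).-tuple nat) (a : (t + t).-tuple G) :
  denotes nu v a -> denotes nu (rtup v) (rtup a).
Proof. by move=> va k; rewrite !tnth_mktuple. Qed.

Lemma denotes_update n (G : graph) nu (y : n.-tuple nat) (w : n.-tuple G) :
  uniq y -> denotes (update nu y w) y w.
Proof.
move=> uy k; rewrite /update mem_tnth (tnth_nth 0) index_uniq ?size_tuple //.
by rewrite onthE (nth_map (tnth w k)) ?size_tuple // -tnth_nth.
Qed.

Lemma denotes_update_out m n (G : graph) nu (x : m.-tuple nat) (a : m.-tuple G)
    (y : n.-tuple nat) (w : n.-tuple G) :
  ~~ has [in y] x -> denotes nu x a -> denotes (update nu y w) x a.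
Proof.
move=> /hasPn xy xa k; rewrite /update ifN ?xa //.
exact/xy/mem_tnth.
Qed.

(** Formulae record their free variables as a set, so two orderings of them differ by a permutation,
    which a half-round of the colouring absorbs. *)
Lemma eq_fset_permt n (v v' : n.-tuple nat) : uniq v -> uniq v' ->
  [fset z in (v : seq nat)]%fset = [fset z in (v' : seq nat)]%fset ->
  exists s, v' = permt s v.
Proof.
move=> uv uv' /fsetP vv'; have /tuple_permP [s vE] : perm_eq v' v.
  by apply: uniq_perm => // z; have := vv' z; rewrite !inE.
by exists s; apply: val_inj.
Qed.

Lemma fset_permt n (v : n.-tuple nat) (s : 'S_n) :
  [fset z in (permt s v : seq nat)]%fset = [fset z in (v : seq nat)]%fset.
Proof.
apply/fsetP => z; rewrite !inE.
have /perm_mem -> // : perm_eq (permt s v) v.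
by apply/tuple_permP; exists s.
Qed.

Lemma uniq_permt n (v : n.-tuple nat) (s : 'S_n) : uniq v -> uniq (permt s v).
Proof.
move=> uv; have /perm_uniq -> // : perm_eq (permt s v) v.
by apply/tuple_permP; exists s.
Qed.

Lemma uniq_cat3 (x y z : seq nat) : uniq (x ++ y ++ z) ->
  [/\ uniq y, uniq (x ++ y), uniq (y ++ z), uniq (x ++ z) &
      ~~ has [in y] x /\ ~~ has [in y] z].
Proof.
rewrite !cat_uniq has_cat negb_or => /and5P[-> /andP[yx zx] -> zy ->] /=.
by rewrite yx zx zy; split=> //; split=> //; rewrite has_sym.
Qed.

Lemma sat_atp t (G H : graph) nu nu' (v : (t + t).-tuple nat)
    (a : (t + t).-tuple G) (b : (t + t).-tuple H) phi :
  denotes nu v a -> denotes nu' v b -> atp a = atp b ->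
  quantifier_free phi -> {subset free_vars phi <= v} -> sat nu phi = sat nu' phi.
Proof.
move=> va vb ab.
have var z : z \in v -> exists k, nu z = Some (tnth a k) /\ nu' z = Some (tnth b k).
  by move=> /tnthP [k ->]; exists k; rewrite va vb.
have abE k l : (tnth a k == tnth a l) = (tnth b k == tnth b l) /\
    edge (tnth a k) (tnth a l) = edge (tnth b k) (tnth b l).
  by have /ffunP /(_ (k, l)) := ab; rewrite !ffunE => -[].
elim: phi => [x y|x y|phi IH|phi IH psi IH'|phi IH psi IH'|//] /=.
- move=> _ s.
  have /var [k [-> ->]] : x \in v by apply: s; rewrite !inE eqxx.
  have /var [l [-> ->]] : y \in v by apply: s; rewrite !inE eqxx orbT.
  by case: (abE k l).
- move=> _ s.
  have /var [k [-> ->]] : x \in v by apply: s; rewrite !inE eqxx.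
  have /var [l [-> ->]] : y \in v by apply: s; rewrite !inE eqxx orbT.
  by case: (abE k l).
- by move=> qf s; rewrite IH.
- move=> /andP[qf qf'] s; rewrite IH ?IH' // => z zf; apply: s;
    by rewrite inE zf ?orbT.
- move=> /andP[qf qf'] s; rewrite IH ?IH' // => z zf; apply: s;
    by rewrite inE zf ?orbT.
Qed.

Lemma card_bij (A A' : finType) (f : A -> A') (P : pred A) (P' : pred A') :
  bijective f -> (forall a, P a = P' (f a)) -> #|[set a | P a]| = #|[set a | P' a]|.
Proof.
move=> bf PP'; rewrite -!sum1dep_card [RHS](reindex f (onW_bij _ bf)).
exact: eq_bigl.
Qed.

(** The round depends on the formula alone, and the claim covers every ordering [v] of its free
    variables so that the induction can reorder them. *)
Lemma sat_mwl t X phi : Mformula t X phi ->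
  exists i, forall (G H : graph) nu nu' (v : (t + t).-tuple nat)
    (a : (t + t).-tuple G) (b : (t + t).-tuple H),
    uniq v -> X = [fset z in (v : seq nat)]%fset ->
    denotes nu v a -> denotes nu' v b ->
    mwl i a = mwl i b -> sat nu phi = sat nu' phi.
Proof.
elim=> {X phi} [X phi _ qf /fsubsetP sX|X phi _ [i hi]|X phi psi _ [i hi] _ [j hj]
  |X phi psi _ [i hi] _ [j hj]|n x y z phi psi u _ [i hi] _ [j hj]].
- exists 0 => G H nu nu' v a b uv XE va vb ab; apply: (sat_atp va vb ab qf) => z /sX.
  by rewrite XE inE.
- by exists i => G H nu nu' v a b uv XE va vb ab /=; rewrite (hi _ _ _ _ _ _ _ uv XE va vb ab).
- exists (maxn i j) => G H nu nu' v a b uv XE va vb ab /=.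
  rewrite (hi _ _ _ _ _ _ _ uv XE va vb) ?(hj _ _ _ _ _ _ _ uv XE va vb) //;
    by apply: mwl_leq ab; rewrite (leq_maxl, leq_maxr).
- exists (maxn i j) => G H nu nu' v a b uv XE va vb ab /=.
  rewrite (hi _ _ _ _ _ _ _ uv XE va vb) ?(hj _ _ _ _ _ _ _ uv XE va vb) //;
    by apply: mwl_leq ab; rewrite (leq_maxl, leq_maxr).
have [uy uxy uyz uxz [xy zy]] := uniq_cat3 u.
(* One extra round permutes [v] into the order [x], [z]; the other plays the game that matches the
   witnesses for [y]. *)
exists (maxn i j).+2 => G H nu nu' v a b uv XE va vb /mwl_half ab.
have [s vE] := @eq_fset_permt _ v (cat_tuple x z) uv uxz (esym XE).
have xa := denotes_permt s va; have xb := denotes_permt s vb.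
move: xa xb (ab s); rewrite -vE; move: (permt s a) (permt s b) => {ab va vb}a {}b va vb ab.
have [f bf hf] := mwl_game ab; rewrite /=.
rewrite (card_assign nu y (fun m => sat m phi && sat m psi)).
rewrite (card_assign nu' y (fun m => sat m phi && sat m psi)).
congr (_ <= _); apply: (card_bij bf) => w; have [h1 h2] := hf w.
have xl := denotes_ltup va; have xr := denotes_rtup va.
have yl := denotes_ltup vb; have yr := denotes_rtup vb.
rewrite ltup_cat in xl yl; rewrite rtup_cat in xr yr.
congr (_ && _).
- apply: (hi _ _ _ _ (cat_tuple x y)) (mwl_leq (leq_maxl i j) h1) => //.
  + by apply: denotes_cat; [apply: denotes_update_out | apply: denotes_update].
  + by apply: denotes_cat; [apply: denotes_update_out | apply: denotes_update].
- apply: (hj _ _ _ _ (cat_tuple y z)) (mwl_leq (leq_maxr i j) h2) => //.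
  + by apply: denotes_cat; [apply: denotes_update | apply: denotes_update_out].
  + by apply: denotes_cat; [apply: denotes_update | apply: denotes_update_out].
Qed.

Lemma mwl_sentences t (G H : graph) :
  mwl_not_distinguished t G H -> same_Msentences t G H.
Proof.
move=> [f bf hf] _ [n x phi ux Mphi]; have [i hi] := sat_mwl Mphi.
rewrite /models /=.
rewrite (card_assign _ x (fun m => sat m phi)) (card_assign _ x (fun m => sat m phi)).
suff -> : #|[set w : (t + t).-tuple G | sat (update (fun=> None) x w) phi]| =
  #|[set w : (t + t).-tuple H | sat (update (fun=> None) x w) phi]| by [].
apply: (card_bij bf) => w.
by apply: (hi _ _ _ _ x w (f w)) (hf w i) => //; apply: denotes_update.
Qed.

(** * Definable families of tuples, and from sentences to colours *)

Section Definable.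

Variables (t : nat) (I : finType) (Gs : I -> graph).

Definition tuple_pred := forall i, pred ((t + t).-tuple (Gs i)).

Implicit Types P Q : tuple_pred.

(** One formula serves all graphs of the family, but a formula is required for each naming [v] of
    the positions; permuting positions and choosing bound variables rely on this freedom. *)
Definition definable P : Prop := forall v : (t + t).-tuple nat, uniq v ->
  exists2 phi, Mformula t [fset z in (v : seq nat)]%fset phi &
    forall i nu (a : (t + t).-tuple (Gs i)), denotes nu v a -> sat nu phi = P i a.

Lemma definable_qf (mk : (t + t).-tuple nat -> formula) P :
  (forall v, quantifier_free (mk v)) ->
  (forall v, {subset free_vars (mk v) <= v}) ->
  (forall v i nu (a : (t + t).-tuple (Gs i)), denotes nu v a -> sat nu (mk v) = P i a) ->
  definable P.
Proof.
move=> qf fv mkP v uv; exists (mk v); last exact: mkP.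
apply: M_qf => //; last by apply/fsubsetP => z /fv; rewrite inE.
by rewrite card_fseq undup_id ?size_tuple.
Qed.

Lemma definable_eq k l : definable (fun i a => tnth a k == tnth a l).
Proof.
apply: (definable_qf (mk := fun v => FEq (tnth v k) (tnth v l))) => //=.
  by move=> v z; rewrite !inE => /orP[] /eqP ->; apply: mem_tnth.
by move=> v i nu a va; rewrite !va.
Qed.

Lemma definable_edge k l : definable (fun i a => edge (tnth a k) (tnth a l)).
Proof.
apply: (definable_qf (mk := fun v => FEdge (tnth v k) (tnth v l))) => //=.
  by move=> v z; rewrite !inE => /orP[] /eqP ->; apply: mem_tnth.
by move=> v i nu a va; rewrite !va.
Qed.

Lemma definable_and P Q : definable P -> definable Q -> definable (fun i a => P i a && Q i a).
Proof.
move=> dP dQ v uv; have [phi Mphi hphi] := dP v uv; have [psi Mpsi hpsi] := dQ v uv.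
exists (FAnd phi psi); first exact: M_and.
by move=> i nu a va /=; rewrite (hphi _ _ _ va) (hpsi _ _ _ va).
Qed.

(** Permuting the names instead of the values leaves the set of free variables unchanged. *)
Lemma definable_perm P s : definable P -> definable (fun i a => P i (permt s a)).
Proof.
move=> dP v uv; have [phi Mphi hphi] := dP (permt s v) (uniq_permt s uv).
exists phi; first by rewrite -(fset_permt v s).
by move=> i nu a va; apply/hphi/denotes_permt.
Qed.

Lemma fresh_tuple (v : (t + t).-tuple nat) : uniq v ->
  exists y : t.-tuple nat, uniq (ltup v ++ y ++ rtup v).
Proof.
(* Consecutive numbers starting above every entry of [v] are fresh. *)
move=> uv; pose m := (\max_(z <- v) z).+1; exists (iota_tuple t m).
have lt_m z : z \in v -> z < m.
  by move=> zv; rewrite ltnS; apply: (leq_bigmax_seq (F := id)) zv _.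
rewrite uniq_catCA -[iota_tuple t m ++ _]/(iota m t ++ cat_tuple (ltup v) (rtup v)).
rewrite cat_ltup_rtup cat_uniq iota_uniq uv andbT /=.
by apply/hasPn => z /lt_m; rewrite mem_iota ltnNge => /negbTE ->.
Qed.

Lemma definable_count n P Q : definable P -> definable Q ->
  definable (fun i a => n <= #|[set w : t.-tuple (Gs i) |
    P i (cat_tuple (ltup a) w) && Q i (cat_tuple w (rtup a))]|).
Proof.
move=> dP dQ v uv; have [y u] := fresh_tuple uv.
have [uy uxy uyz _ [xy zy]] := uniq_cat3 u.
have [phi Mphi hphi] := dP (cat_tuple (ltup v) y) uxy.
have [psi Mpsi hpsi] := dQ (cat_tuple y (rtup v)) uyz.
exists (FExists n y (FAnd phi psi)).
  have := M_exists n u Mphi Mpsi.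
  by rewrite -[ltup v ++ rtup v]/(tval (cat_tuple (ltup v) (rtup v))) cat_ltup_rtup.
move=> i nu a va /=.
rewrite (card_assign nu y (fun m => sat m phi && sat m psi)).
congr (_ <= _); apply: eq_card => w; rewrite !inE.
have xa := denotes_ltup va; have za := denotes_rtup va.
congr (_ && _).
  by apply/hphi/denotes_cat; [apply: denotes_update_out | apply: denotes_update].
by apply/hpsi/denotes_cat; [apply: denotes_update | apply: denotes_update_out].
Qed.

(** Sentences express only lower bounds; taking each of the two cardinalities as the bound [n] gives
    both inequalities. *)
Lemma definable_card P i j :
  (forall phi, Msentence t phi -> models (Gs i) phi <-> models (Gs j) phi) ->
  definable P -> #|[set a | P i a]| = #|[set a | P j a]|.
Proof.
move=> same dP; pose v := iota_tuple (t + t) 0.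
have uv : uniq v by apply: iota_uniq.
have [phi Mphi hphi] := dP v uv.
have cardP k n : models (Gs k) (FExists n v phi) <-> n <= #|[set a | P k a]|.
  rewrite /models /= (card_assign _ v (fun m => sat m phi)).
  suff -> : [set w : (t + t).-tuple (Gs k) | sat (update (fun=> None) v w) phi] =
    [set a | P k a] by [].
  by apply/setP => a; rewrite !inE; apply/hphi/denotes_update.
have le_card k l n : (models (Gs k) (FExists n v phi) -> models (Gs l) (FExists n v phi)) ->
    n <= #|[set a | P k a]| -> n <= #|[set a | P l a]|.
  by move=> kl /cardP /kl /cardP.
apply/eqP; rewrite eqn_leq; apply/andP; split; apply: le_card (leqnn _);
  by have /same [] := M_sentence #|[set a | P i a]| uv Mphi;
     have /same [] := M_sentence #|[set a | P j a]| uv Mphi.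
Qed.

End Definable.

Lemma sentences_mwl t (G H : graph) : 1 <= t ->
  same_Msentences t G H -> mwl_not_distinguished t G H.
Proof.
move=> t_gt0 GH; pose Gs b := if b then G else H.
pose B (f : valuation t Gs) := exists2 P : tuple_pred t Gs, definable P &
  forall b x, f b x = (P b x)%:R%R.
have dB (P : tuple_pred t Gs) : definable P -> B (fun b x => (P b x)%:R%R) by exists P.
(* A position exists because [t] is positive; the constant 1 is then the truth value of the equation
   between this position and itself. *)
have k0 : 'I_(t + t) by apply: (@Ordinal _ 0); rewrite addn_gt0 t_gt0.
apply: (@separation_mwl t bool Gs B _ _ _ _ _ _ true false).
- apply: (span_ext _ (span_gen (dB _ (definable_eq Gs k0 k0)))) => b x.
  by rewrite eqxx.
- move=> f g [P dP fE] [Q dQ gE].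
  apply: (span_ext _ (span_gen (dB _ (definable_and dP dQ)))) => b x.
  by rewrite /val_mul fE gE -natrM mulnb.
- move=> s f [P dP fE].
  apply: (span_ext _ (span_gen (dB _ (definable_perm s dP)))) => b x.
  by rewrite /val_perm fE.
- move=> f g [P dP fE] [Q dQ gE].
  (* Each threshold predicate is definable, and a count [c] at most [N] is the sum over [n < N] of
     the indicators of [n < c]. The bound [N] holds in both graphs, so one finite combination works
     for the whole family. *)
  pose N := \max_b #|{: t.-tuple (Gs b)}|.
  pose F n : valuation t Gs := fun i a => (n < #|[set w : t.-tuple (Gs i) |
    P i (cat_tuple (ltup a) w) && Q i (cat_tuple w (rtup a))]|)%:R%R.
  have BF n : span B (F n) by apply/span_gen/dB/definable_count.
  apply: (span_ext _ (span_sum (index_enum 'I_N) (BF 0) BF)) => b x.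
  rewrite /F /val_series sumr_card.
  under [RHS]eq_bigr do rewrite fE gE -natrM mulnb.
  rewrite sumr_card; congr (_%:R)%R.
  set c := #|[set w : t.-tuple _ | _]|.
  have cN : c <= N.
    exact: leq_trans (max_card _) (@leq_bigmax _ (fun b => #|{: t.-tuple (Gs b)}|) b).
  by rewrite -sum1dep_card -(big_ord_widen _ (fun=> 1) cN) sum1_card card_ord.
- move=> f i j [P dP fE].
  under eq_bigr do rewrite fE; under [RHS]eq_bigr do rewrite fE.
  rewrite !sumr_card; congr (_%:R)%R; apply: definable_card dP => phi Mphi.
  by case: i; case: j; rewrite /= ?(GH _ Mphi).
- move=> i j x y xy; apply/ffunP => -[k l]; rewrite !ffunE /=.
  have simP (P : tuple_pred t Gs) : definable P -> P i x = P j y.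
    by move=> /dB /xy /eqP; rewrite eqr_nat; case: (P i x); case: (P j y).
  congr pair; [exact: (simP _ (definable_eq Gs k l)) | exact: (simP _ (definable_edge Gs k l))].
Qed.

Theorem theorem5p3 (t : nat) (ht : 1 <= t) (G H : graph)
    (hG : simple_graph G) (hH : simple_graph H) :
  (mwl_not_distinguished t G H <-> hom_indistinguishable_Lplus t G H) /\
  (hom_indistinguishable_Lplus t G H <-> same_Msentences t G H).
Proof.
split; split.
- exact: mwl_hom.
- exact: hom_mwl.
- by move/hom_mwl/mwl_sentences.
- by move/(sentences_mwl ht)/mwl_hom.
Qed.
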